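(* Let $H$ be a real Hilbert space and let $\gamma>0$, $L>0$, $\alpha>0$. Let $B:H\to H$ be a single-valued $L$-Lipschitz continuous mapping, and let $A:H\rightrightarrows H$ be a set-valued mapping such that the resolvent $J_{\gamma A}=(Id+\gamma A)^{-1}$ is well-defined and single-valued on $H$ and such that $A+B$ is maximally $\alpha$-strongly monotone. Suppose that $\gamma^2L^2\le 1-2\gamma\alpha$. Then, for every $x_0\in H$, the sequence $(x_k)_{k\ge 0}$ generated by Tseng's algorithm $$ \begin{cases} y_k=J_{\gamma A}(x_k-\gamma Bx_k),\\ x_{k+1}=y_k+\gamma(Bx_k-By_k), \end{cases}\qquad k\ge 0, $$ converges linearly to the unique solution $\tilde{x}$ of the inclusion $0\in Ax+Bx$.
   Context: $H$ is a real Hilbert space with inner product $\langle\cdot,\cdot\rangle$ and norm $\|\cdot\|$. A mapping $B:H\to H$ is $L$-Lipschitz continuous if $\|Bx-By\|\le L\|x-y\|$ for all $x,y\in H$. A set-valued mapping $\mathcal F:H\rightrightarrows H$ is monotone if $\langle x^*-y^*,x-y\rangle\ge 0$ for all $x,y\in H$, $x^*\in\mathcal F(x)$, $y^*\in\mathcal F(y)$; it is maximally monotone if it is monotone and there is no monotone operator whose graph strictly contains the graph of $\mathcal F$. It is $\alpha$-strongly monotone if $\langle x^*-y^*,x-y\rangle\ge\alpha\|x-y\|^2$ for all $x,y\in H$, $x^*\in\mathcal F(x)$, $y^*\in\mathcal F(y)$; maximally $\alpha$-strongly monotone means maximally monotone and $\alpha$-strongly monotone. The sum is $(A+B)x=\{a+Bx: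 a\in Ax\}$. The resolvent is $J_{\gamma A}:=(Id+\gamma A)^{-1}$, where $Id$ is the identity; that it is well-defined and single-valued on $H$ means that for every $u\in H$ there is exactly one $y\in H$ with $u\in y+\gamma Ay$. Linear convergence of $(x_k)$ to $\tilde x$ means that there is a constant $q\in[0,1)$, independent of $k$, such that $\|x_{k+1}-\tilde x\|\le q\|x_k-\tilde x\|$ for all $k\ge 0$. Neither $A$ nor $B$ is assumed monotone individually. *)

(* Defs.v *)
From mathcomp Require Export all_boot all_order all_algebra.
From mathcomp Require Export all_classical all_reals all_analysis.

Set Implicit Arguments.
Unset Strict Implicit.
Unset Printing Implicit Defensive.

Export Order.TTheory GRing.Theory Num.Theory.
Export numFieldNormedType.Exports.

Local Open Scope classical_set_scope.
Local Open Scope ring_scope.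

(* A real Hilbert space is a complete normed module [H] over a real type
   together with a positive definite symmetric bilinear form [dot] that induces
   the norm of [H], i.e. [forall x, dot x x = `|x| ^+ 2]; this last equation is
   a hypothesis wherever it is needed.  A set-valued operator on [H] is a map
   [H -> set H]. *)

Section Operators.
Context {R : realType} {H : completeNormedModType R}.
Implicit Types (A F : H -> set H) (B : H -> H) (g : R).

Definition graph F : set (H * H) := [set p | F p.1 p.2].

Definition op_inv F : H -> set H := fun u => [set y | F y u].

Definition op_add A B : H -> set H := fun x => [set a + B x | a in A x].

Definition id_add_scale g A : H -> set H := fun x => [set x + g *: a | a in A x].

Definition resolvent g A : H -> set H := op_inv (id_add_scale g A).

Definition resolvent_single_valued g A : Prop :=
  forall u, exists! y, resolvent g A u y.

(* The value 0 is only a default for an empty resolvent. *)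
Definition resolvent_map g A (u : H) : H := xget 0 (resolvent g A u).

Lemma resolvent_mapP g A (u y : H) : resolvent_single_valued g A ->
  resolvent g A u y <-> y = resolvent_map g A u.
Proof.
move=> /(_ u) [z [Az zuniq]].
have Am : resolvent g A u (resolvent_map g A u) by exact: xgetI Az.
by split=> [/zuniq <-|-> //]; exact: zuniq.
Qed.

Definition tseng_step g A B (x : H) : H :=
  let y := resolvent_map g A (x - g *: B x) in y + g *: (B x - B y).

Definition tseng g A B (x0 : H) (k : nat) : H := iter k (tseng_step g A B) x0.

Definition converges_linearly (x : nat -> H) (l : H) : Prop :=
  exists2 q : R, 0 <= q < 1 & forall k, `|x k.+1 - l| <= q * `|x k - l|.

End Operators.

Section Monotonicity.
Context {R : realType} {H : completeNormedModType R}.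
Variable dot : {dot H for idfun}.
Implicit Types F G : H -> set H.

Definition monotone F : Prop :=
  forall x y u v, F x u -> F y v -> 0 <= dot (u - v) (x - y).

Definition maximally_monotone F : Prop :=
  monotone F /\ ~ exists G, monotone G /\ graph F `<` graph G.

Definition strongly_monotone (a : R) F : Prop :=
  forall x y u v, F x u -> F y v -> a * `|x - y| ^+ 2 <= dot (u - v) (x - y).

Definition maximally_strongly_monotone (a : R) F : Prop :=
  maximally_monotone F /\ strongly_monotone a F.

End Monotonicity.

(* Main.v *)
Require Import Defs.
From mathcomp Require Import lra.

Set Implicit Arguments.
Unset Strict Implicit.
Unset Printing Implicit Defensive.

Local Open Scope classical_set_scope.
Local Open Scope ring_scope.

(* Existence of a zero does not use Minty's theorem: since A + B is strongly
   monotone and gamma L < 1, the operator A + Id / gamma is strongly monotone as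
   well, and it is surjective because the resolvent of A is everywhere defined.
   All convex combinations of A + Id / gamma and A + B are then strongly monotone
   with a common constant, and surjectivity propagates from the former to the
   latter by the method of continuity, each small step being an application of
   Banach's fixed point theorem.

   For the convergence, let x be an iterate, y the resolvent point, x' the next
   iterate and z the zero. Then (x - x') / gamma lies in (A + B) y, and expanding
   the squares gives
     |x - z|^2 - |x' - z|^2
       = |x - y|^2 - |x' - y|^2 + 2 <x - x', y - z>
       >= (1 - gamma^2 L^2) |x - y|^2 + 2 gamma alpha |y - z|^2
       >= 2 gamma alpha (|x - y|^2 + |y - z|^2) >= gamma alpha |x - z|^2. *)

Lemma lipschitzP (R : realType) (V : normedModType R) (K : R) (f : V -> V) :
  K.-lipschitz f <-> forall x y, `|f x - f y| <= K * `|x - y|.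
Proof.
by split=> [fK x y|fK [x y] _]; [exact: (fK (x, y)) | exact: fK].
Qed.

Lemma lipschitz_fixed_point (R : realType) (H : completeNormedModType R)
    (q : R) (f : H -> H) :
  0 <= q -> q < 1 -> q.-lipschitz f -> exists x, x = f x.
Proof.
move=> q0 q1 fq.
have fcontr : is_contraction ('totalfun_setT f : {fun [set: H] >-> [set: H]}).
  by exists (NngNum q0).
have [x _ xE] := banach_fixed_point fcontr closedT (ex_intro _ 0 I).
by exists x.
Qed.

Section StronglyMonotone.
Context (R : realType) (H : completeNormedModType R).
Variables (dot : {dot H for idfun}).
Hypothesis dotE : forall x : H, dot x x = `|x| ^+ 2.
Implicit Types (A F : H -> set H) (B P : H -> H) (c K t : R).

Lemma dotC (x y : H) : dot x y = dot y x.
Proof. by rewrite hermC expr0 mul1r. Qed.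

Lemma dotDl (x y z : H) : dot (x + y) z = dot x z + dot y z.
Proof. exact: linearDl. Qed.

Lemma dotDr (x y z : H) : dot z (x + y) = dot z x + dot z y.
Proof. exact: linearDr. Qed.

Lemma dotNl (x z : H) : dot (- x) z = - dot x z.
Proof. exact: linearNl. Qed.

Lemma dotNr (x z : H) : dot z (- x) = - dot z x.
Proof. exact: linearNr. Qed.

Lemma dotZl t (x z : H) : dot (t *: x) z = t * dot x z.
Proof. exact: linearZl_LR. Qed.

Lemma dotZr t (x z : H) : dot z (t *: x) = t * dot z x.
Proof. by rewrite dotC dotZl dotC. Qed.

Definition dot_expand := (dotDl, dotDr, dotNl, dotNr, dotZl, dotZr).

(** Cauchy-Schwarz: the squared norm of [|y| x - |x| y] is nonnegative and equals
    [2 |x| |y| (|x| |y| - <x, y>)]. *)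
Lemma dot_le_norm (x y : H) : dot x y <= `|x| * `|y|.
Proof.
have [->|x0] := eqVneq x 0; first by rewrite linear0l normr0 mul0r.
have [->|y0] := eqVneq y 0; first by rewrite linear0r normr0 mulr0.
have xy_gt0 : 0 < `|x| * `|y| by rewrite mulr_gt0 // normr_gt0.
have : 0 <= dot (`|y| *: x - `|x| *: y) (`|y| *: x - `|x| *: y).
  by rewrite dotE sqr_ge0.
rewrite !dot_expand !dotE (dotC y x) => sq_ge0.
rewrite -(ler_pM2l xy_gt0); lra.
Qed.

Lemma strongly_monotone_expansive c F (x y u v : H) :
  strongly_monotone dot c F -> F x u -> F y v -> c * `|x - y| <= `|u - v|.
Proof.
move=> Fc Fxu Fyv.
have [->|xy] := eqVneq x y; first by rewrite subrr normr0 mulr0.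
have xy_gt0 : 0 < `|x - y| by rewrite normr_gt0 subr_eq0.
rewrite -(ler_pM2r xy_gt0) -mulrA -expr2.
by apply: le_trans (dot_le_norm _ _); exact: Fc.
Qed.

(** A selection [S] of the inverse of [F] is [1/c]-Lipschitz, so [S (u - P x)] is a contraction in
    [x] with factor [K/c]; its fixed point is the required [x]. *)
Lemma surjective_op_add_lipschitz c K F P :
  0 <= K -> K < c -> strongly_monotone dot c F -> K.-lipschitz P ->
  (forall u, exists x, F x u) -> forall u, exists x, op_add F P x u.
Proof.
move=> K0 Kc Fc /lipschitzP PK /choice [S FS] u.
have c0 : 0 < c := le_lt_trans K0 Kc.
have [|||x xE] := @lipschitz_fixed_point R H (K / c) (fun x => S (u - P x)).
- by rewrite divr_ge0 // ltW.
- by rewrite ltr_pdivrMr // mul1r.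
- apply/lipschitzP => x y; rewrite mulrAC ler_pdivlMr // [leLHS]mulrC.
  apply: le_trans (strongly_monotone_expansive Fc (FS _) (FS _)) _.
  have -> : u - P x - (u - P y) = - (P x - P y).
    by rewrite !opprB addrC addrA subrK.
  by rewrite normrN.
by exists x; exists (u - P x); rewrite ?subrK //= {1}xE; exact: FS.
Qed.

(** The pairing for [F + t P] is the convex combination, with weights [1 - t] and [t], of those for
    [F] and [F + P]. *)
Lemma strongly_monotone_segment c t F P : 0 <= t <= 1 ->
  strongly_monotone dot c F -> strongly_monotone dot c (op_add F P) ->
  strongly_monotone dot c (op_add F (t \*: P)).
Proof.
move=> /andP[t0 t1] Fc FPc x y _ _ [a Fa <-] [b Fb <-] /=.
have ab := Fc _ _ _ _ Fa Fb.
have abP : c * `|x - y| ^+ 2 <= dot (a + P x - (b + P y)) (x - y).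
  by apply: FPc; [exists a | exists b].
have {}ab := ler_wpM2l (_ : 0 <= 1 - t) ab.
have {}abP := ler_wpM2l t0 abP.
have := lerD (ab _) abP; rewrite subr_ge0 => /(_ t1).
move: (x - y) => e; rewrite !dot_expand; lra.
Qed.

(** The constant [c] is the same along the whole path [F + t P], so [n] equal steps suffice once
    [K/n < c]: each adds the [K/n]-Lipschitz perturbation [P/n]. *)
Lemma surjective_continuation c K F P :
  0 < c -> 0 <= K -> K.-lipschitz P ->
  strongly_monotone dot c F -> strongly_monotone dot c (op_add F P) ->
  (forall u, exists x, F x u) -> forall u, exists x, op_add F P x u.
Proof.
move=> c0 K0 /lipschitzP PK Fc FPc Fsurj.
pose n := (Num.trunc (K / c)).+1.
have n0 : 0 < n%:R :> R by rewrite ltr0n.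
have Kn : K / n%:R < c.
  rewrite ltr_pdivrMr // mulrC -ltr_pdivrMr //; exact: truncnS_gt.
suff step k : (k <= n)%N ->
    forall u, exists x, op_add F ((k%:R / n%:R) \*: P) x u.
  move=> u; have [x [a Fa /= au]] := step n (leqnn n) u.
  by exists x, a; rewrite // -au divff ?scale1r // gt_eqF.
elim: k => [_ u|k IHk kn u].
  by have [x Fx] := Fsurj u; exists x, u; rewrite //= mul0r scale0r addr0.
have [|||||x [_ [a Fa <-] <-]] := @surjective_op_add_lipschitz c (K / n%:R)
    (op_add F ((k%:R / n%:R) \*: P)) (n%:R^-1 \*: P) _ _ _ _ _ u => //.
- by rewrite divr_ge0 // ltW.
- apply: strongly_monotone_segment => //.
  by rewrite divr_ge0 ?ler0n //= ler_pdivrMr // mul1r ler_nat ltnW.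
- apply/lipschitzP => x y /=; rewrite -scalerBr normrZ gtr0_norm ?invr_gt0 //.
  by rewrite [K / _]mulrC -mulrA ler_pM2l ?invr_gt0.
- exact/IHk/ltnW.
by exists x, a; rewrite //= -addrA -scalerDl -natr1 mulrDl mul1r.
Qed.

End StronglyMonotone.

Section Tseng.
Context (R : realType) (H : completeNormedModType R).
Variables (dot : {dot H for idfun}).
Hypothesis dotE : forall x : H, dot x x = `|x| ^+ 2.
Variables (gamma L alpha : R) (A : H -> set H) (B : H -> H).
Hypotheses (gamma_gt0 : 0 < gamma) (L_gt0 : 0 < L) (alpha_gt0 : 0 < alpha).
Hypothesis B_lip : L.-lipschitz B.
Hypothesis resolventA : resolvent_single_valued gamma A.
Hypothesis AB_strong : strongly_monotone dot alpha (op_add A B).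
Hypothesis gammaLalpha : gamma ^+ 2 * L ^+ 2 <= 1 - 2 * gamma * alpha.

Lemma op_add_surjective u : exists x, op_add A B x u.
Proof.
pose J x := gamma^-1 *: x : H.
(* The second term is the constant for [A + J]: [alpha] from [A + B], a loss of at most [L] for
   removing [B], and a gain of [1/gamma] from [J]. *)
pose c := Num.min alpha (gamma^-1 + alpha - L).
have gV0 : 0 < gamma^-1 by rewrite invr_gt0.
have gL : gamma * L < 1.
  rewrite -(@ltr_pXn2r _ 2%N) ?nnegrE ?ler01 //; last by rewrite ltW ?mulr_gt0.
  have : 0 < gamma * alpha by rewrite mulr_gt0.
  by rewrite exprMn expr1n; move: gammaLalpha; lra.
have LgV : L < gamma^-1.
  by rewrite -[ltRHS]mul1r ltr_pdivlMr // mulrC.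
have c0 : 0 < c by rewrite lt_min alpha_gt0 subr_gt0 (lt_trans LgV) // ltrDl.
have cW (a : R) F : c <= a -> strongly_monotone dot a F ->
    strongly_monotone dot c F.
  move=> ca Fa x y v w Fxv Fyw; apply: le_trans (Fa _ _ _ _ Fxv Fyw).
  by rewrite ler_wpM2r ?sqr_ge0.
(* The path of operators leads from [A + J] to [A + B] along the perturbation [B - J]. *)
have JP : op_add (op_add A J) (fun x => B x - J x) = op_add A B.
  apply/funext => x; apply/seteqP; split => v.
  - by move=> [_ [a Aa <-] <-]; exists a; rewrite //= addrACA subrr addr0.
  - move=> [a Aa <-]; exists (a + J x); first by exists a.
    by rewrite addrACA subrr addr0.
move/lipschitzP: B_lip => BL.
rewrite -JP.
apply: (@surjective_continuation _ _ _ dotE c (L + gamma^-1)) => //.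
- by rewrite addr_ge0 ?ltW.
- apply/lipschitzP => x y.
  have -> : B x - J x - (B y - J y) = (B x - B y) - gamma^-1 *: (x - y).
    rewrite scalerBr !opprB addrACA [RHS]addrACA.
    by congr (_ + _); rewrite addrC.
  apply: le_trans (ler_normB _ _) _.
  by rewrite mulrDl normrZ gtr0_norm // lerD2r.
- apply: (cW (gamma^-1 + alpha - L)); first by rewrite ge_min lexx orbT.
  move=> x y _ _ [a Aa <-] [b Ab <-].
  have AB : alpha * `|x - y| ^+ 2 <= dot (a + B x - (b + B y)) (x - y).
    by apply: AB_strong; [exists a | exists b].
  have BB : dot (B x - B y) (x - y) <= L * `|x - y| ^+ 2.
    apply: le_trans (dot_le_norm dotE _ _) _.
    by rewrite expr2 mulrA ler_wpM2r.
  have -> : a + J x - (b + J y) =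
      (a + B x - (b + B y)) - (B x - B y) + gamma^-1 *: (x - y).
    by rewrite opprD addrACA [in RHS]opprD [in RHS]addrACA addrK scalerBr.
  rewrite [in leRHS]dotDl [in leRHS]dotDl dotNl dotZl dotE; lra.
- by rewrite JP; apply: (cW alpha) => //; rewrite ge_min lexx.
(* Dividing [y + gamma a = gamma v] by [gamma] shows that [v] lies in [(A + J) y]. *)
- move=> v; have [y [[a Aa ya] _]] := resolventA (gamma *: v).
  exists y, a => //; rewrite /J -[v](scalerK (lt0r_neq0 gamma_gt0)) -ya.
  by rewrite scalerDr scalerK ?lt0r_neq0 // addrC.
Qed.

Lemma tseng_step_contraction (z x : H) : op_add A B z 0 ->
  `|tseng_step gamma A B x - z| ^+ 2 <= (1 - gamma * alpha) * `|x - z| ^+ 2.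
Proof.
move=> ABz; rewrite /tseng_step.
set y := resolvent_map gamma A _; set x' := y + _.
have [a Aya yE] : resolvent gamma A (x - gamma *: B x) y.
  exact/resolvent_mapP.
have x'E : x - x' = gamma *: (a + B y).
  have {1}-> : x = y + gamma *: a + gamma *: B x by rewrite yE subrK.
  rewrite /x' scalerBr scalerDr opprD opprB addrACA [y + _ - y]addrAC subrr add0r.
  by rewrite [gamma *: B x + _]addrC subrK.
have x'y : `|x' - y| <= gamma * L * `|x - y|.
  rewrite /x' addrAC subrr add0r normrZ gtr0_norm // -mulrA.
  rewrite ler_wpM2l ?(ltW gamma_gt0) //.
  by move/lipschitzP: B_lip; apply.
have mono : gamma * (alpha * `|y - z| ^+ 2) <= dot (x - x') (y - z).
  rewrite x'E dotZl ler_pM2l // -[a + B y]subr0.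
  by apply: AB_strong => //; exists a.
have {}x'y : `|x' - y| ^+ 2 <= gamma ^+ 2 * L ^+ 2 * `|x - y| ^+ 2.
  rewrite -!exprMn ler_pXn2r ?nnegrE ?mulr_ge0 //; exact: ltW.
have x'y' := ler_wpM2r (sqr_ge0 `|x - y|) gammaLalpha.
have xzE : x - z = (x - y) + (y - z) by rewrite addrA subrK.
have x'zE : x' - z = (x' - y) + (y - z) by rewrite addrA subrK.
have xx'E : x - x' = (x - y) - (x' - y) by rewrite opprB addrA subrK.
(* This gives [|x - z|^2 <= 2 (|x - y|^2 + |y - z|^2)], used below with the factor [gamma alpha]. *)
have : 0 <= dot ((x - y) - (y - z)) ((x - y) - (y - z)).
  by rewrite dotE sqr_ge0.
have ga : 0 < gamma * alpha by rewrite mulr_gt0.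
move/(ler_wpM2l (ltW ga)).
move: mono x'y x'y'; rewrite xzE x'zE xx'E -!dotE.
move: (x - y) (y - z) (x' - y) => d e d'.
rewrite !dot_expand (dotC _ e d) (dotC _ e d'); lra.
Qed.

End Tseng.

Theorem theorem4 (R : realType) (H : completeNormedModType R)
    (dot : {dot H for idfun}) (dotE : forall x : H, dot x x = `|x| ^+ 2)
    (gamma L alpha : R) (A : H -> set H) (B : H -> H) :
  0 < gamma -> 0 < L -> 0 < alpha ->
  L.-lipschitz B ->
  resolvent_single_valued gamma A ->
  maximally_strongly_monotone dot alpha (op_add A B) ->
  gamma ^+ 2 * L ^+ 2 <= 1 - 2 * gamma * alpha ->
  exists xt : H,
    [/\ op_add A B xt 0,
        forall z : H, op_add A B z 0 -> z = xt &
        forall x0 : H, converges_linearly (tseng gamma A B x0) xt].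
Proof.
move=> g0 L0 a0 BL JA [_ ABa] gLa.
have [xt xt0] := op_add_surjective dotE g0 L0 a0 BL JA ABa gLa 0.
exists xt; split=> // [z z0|x0].
  (* Both zeros have the value 0, so expansiveness bounds [alpha |z - xt|] by 0. *)
  apply/eqP; rewrite -subr_eq0 -normr_le0 -(ler_pM2l a0) mulr0.
  by have := strongly_monotone_expansive dotE ABa z0 xt0; rewrite subrr normr0.
have ga : 0 < gamma * alpha by rewrite mulr_gt0.
have q0 : 0 <= 1 - gamma * alpha.
  have : 0 <= gamma ^+ 2 * L ^+ 2 by rewrite mulr_ge0 ?sqr_ge0.
  lra.
(* The one-step estimate is on squared norms, hence the square root. *)
exists (Num.sqrt (1 - gamma * alpha)).
  by rewrite sqrtr_ge0 /= -[ltRHS]sqrtr1 ltr_sqrt //; lra.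
move=> k.
rewrite -(@ler_pXn2r _ 2%N) ?nnegrE ?mulr_ge0 ?sqrtr_ge0 // exprMn sqr_sqrtr //.
exact: (tseng_step_contraction dotE g0 L0 a0 BL JA ABa gLa _ xt0).
Qed.
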